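(* Let $(\mathcal M,g)$ be an oriented and time-oriented Lorentzian spacetime, $\Gamma=\mathrm{Poin}(\mathcal M,g)$, $(\mathscr H_{\mathcal S},V)$ a system over $\Gamma$, $\mathcal O_{\mathcal S}\subseteq\mathcal A(\mathscr H_{\mathcal S})$ a set of measurable operator fields closed under taking adjoints, $\sigma\ge0$, $\mathcal R$ a general relativistic quantum reference frame, $\pi=(\pi_x:\Gamma^x\to\mathcal M)$ a family of measurable projections, and $\mathfrak S_{\mathcal R}\subset\mathscr S(\mathscr H_{\mathcal R})$ convex. Then: 1. if $\mathcal O_{\mathcal S}$ is absolutely $(\sigma,\pi)$-microcausal, then it is strongly $(\mathfrak S_{\mathcal R},\sigma,\pi)$-microcausal (for any such $\mathfrak S_{\mathcal R}$); 2. if $\mathcal O_{\mathcal S}$ is strongly $(\mathfrak S_{\mathcal R},\sigma,\pi)$-microcausal, then it is weakly $(\mathfrak S_{\mathcal R},\sigma,\pi)$-microcausal; 3. if $\mathcal O_{\mathcal S}$ is strongly semi $(\mathfrak S_{\mathcal R},\sigma)$-causal, then it is weakly semi $(\mathfrak S_{\mathcal R},\sigma,\pi)$-causal (for any such $\pi$); 4. if $\mathcal O_{\mathcal S}$ is weakly $(\mathfrak S_{\mathcal R},\sigma,\pi)$-microcausal, then it is $(\mathfrak S_{\mathcal R},\sigma,\pi)$-causal.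
   Context: **Poincaré groupoid.** $\Gamma=\mathrm{Poin}(\mathcal M,g)\rightrightarrows\mathcal M$: Lie groupoid whose arrows $x\to y$ are orientation- and time-orientation-preserving linear isometries $T_x\mathcal M\to T_y\mathcal M$; $s,t$ source/target; $\Gamma^x=t^{-1}(x)$; $L_\alpha\beta=\alpha\circ\beta$. $\mu_g$: volume measure; signature mostly minus. **Fields.** Hilbert spaces are complex separable. For a continuous field $\mathscr H=\bigsqcup_x\mathcal H^x$ over $\mathcal M$: $\mathcal A(\mathscr H)=\int^\oplus\mathcal B(\mathcal H^x)d\mu_g$ (essentially bounded measurable operator fields; representatives fixed); $\mathscr S(\mathscr H)$: fields in $\mathcal A(\mathscr H)$ that are density operators a.e. Unitary representation of $\Gamma$: measurable functorial assignment of unitaries $U_\alpha:\mathcal H^{s(\alpha)}\to\mathcal H^{t(\alpha)}$; fibre-wise ultraweakly continuous if $\alpha\mapsto\mathrm{Tr}[U_\alpha\chi_\alpha]$ is continuous for every field $\chi_\alpha\in\mathcal T(\mathcal H^{t(\alpha)},\mathcal H^{s(\alpha)})$ locally a trace-norm uniform limit of finite-rank fields $\sum_j|\xi^j_{s(\alpha)}\rangle\langle\eta^j_{t(\alpha)}|$, $\xi^j,\eta^j$ continuous sections. A system $(\mathscr H_{\mathcal S},V)$: continuous field with such a representation $V$. **Frames.** A general relativistic quantum reference frame $\mathcal R=(U,\mathsf E_{\mathcal R},\mathscr H_{\mathcal R})$: continuous field with fibre-wise ultraweakly continuous unitary representation $U$ of $\Gamma$ and normalized POVMs $\mathsf E^x_{\mathcal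 R}:\mathrm{Bor}(\Gamma^x)\to\mathcal E(\mathcal H^x_{\mathcal R})$, measurable in $x$, covariant ($U_\alpha\mathsf E^{s(\alpha)}_{\mathcal R}(\Delta)U_\alpha^\dagger=\mathsf E^{t(\alpha)}_{\mathcal R}(L_\alpha\Delta)$), and $\mu_g$-admissible (for $\mu_g$-a.e. $x$, $\mu_g(N)=0\Rightarrow\mathsf E^x_{\mathcal R}(s^{-1}(N)\cap\Gamma^x)=0$). $\mathsf F^x_{\mathcal R,\pi}(N):=\mathsf E^x_{\mathcal R}(\pi_x^{-1}(N))$; $\mu^{\mathsf E}_\omega(\cdot)=\mathrm{Tr}[\omega\mathsf E(\cdot)]$. $\mathrm{Loc}_\pi(\mathcal R,\omega):=\bigcup_{x}\mathrm{supp}\,\mu^{\mathsf F^x_{\mathcal R,\pi}}_{\omega_x}$. **Relational fields** of $\phi=(\phi_x)\in\mathcal A(\mathscr H_{\mathcal S})$ (those of $\psi$ are written $\hat\Psi,\hat\psi$): semilocal $\hat\Phi^{\mathcal R}_x(\omega)=\int_{\Gamma^x}V_\beta\phi_{s(\beta)}V_\beta^\dagger\,d\mu^{\mathsf E^x_{\mathcal R}}_{\omega_x}(\beta)$; global $\hat\Phi^{\mathcal R}(\omega)=\int^\oplus\hat\Phi^{\mathcal R}_x(\omega)d\mu_g(x)$; local $\hat\phi^{\mathcal R,\pi}_{x,\omega}(y)=\int_{\pi_x^{-1}(\{y\})}V_\beta\phi_{s(\beta)}V_\beta^\dagger\,d\nu^{\mathcal R,\pi}_{\omega_x}(\beta\mid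 y)$ for $y\in\mathrm{supp}\,\mu^{\mathsf F^x_{\mathcal R,\pi}}_{\omega_x}$, where $\nu^{\mathcal R,\pi}_{\omega_x}(\cdot\mid y)$ is the disintegration (Markov kernel, concentrated on $\pi_x^{-1}(\{y\})$ for a.e. $y$) of $\mu^{\mathsf E^x_{\mathcal R}}_{\omega_x}$ along $\pi_x$: $\mu^{\mathsf E^x_{\mathcal R}}_{\omega_x}(\Delta\cap\pi_x^{-1}(\Lambda))=\int_\Lambda\nu^{\mathcal R,\pi}_{\omega_x}(\Delta\mid y)d\mu^{\mathsf F^x_{\mathcal R,\pi}}_{\omega_x}(y)$. Hence $\hat\Phi^{\mathcal R}_x(\omega)=\int\hat\phi^{\mathcal R,\pi}_{x,\omega}(y)\,d\mu^{\mathsf F^x_{\mathcal R,\pi}}_{\omega_x}(y)$. **Spacelike separation.** $CNN(\mathcal U,\mathcal V)$: pairs $(x,y)\in\mathcal U\times\mathcal V$ in a common geodesically convex normal neighbourhood. $\mathcal U\perp_\sigma\mathcal V$ ($\sigma$-locally spacelike separated) if $\mathcal U\subseteq\mathcal V'$ (causal complement: points not causally related to any point of $\mathcal V$) and $\sup_{(x,y)\in CNN(\mathcal U,\mathcal V)}g_x(\exp_x^{-1}(y),\exp_x^{-1}(y))<-\sigma$ ($\sup\varnothing=-\infty$); $x\perp_\sigma y$ means $\{x\}\perp_\sigma\{y\}$. For density operators $\omega_x,\omega'_y$ on $\mathcal H^x_{\mathcal R},\mathcal H^y_{\mathcal R}$: $\omega_x\perp^{\mathcal R,\pi}_\sigma\omega'_y$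 means $\mathrm{supp}\,\mu^{\mathsf F^x_{\mathcal R,\pi}}_{\omega_x}\perp_\sigma\mathrm{supp}\,\mu^{\mathsf F^y_{\mathcal R,\pi}}_{\omega'_y}$. **Causality conditions** on $\mathcal O_{\mathcal S}$, required for all $\phi,\psi\in\mathcal O_{\mathcal S}$ and (except for the first) all $\omega^{(1)},\omega^{(2)}\in\mathfrak S_{\mathcal R}$; ''commute'' for $(X,Y)$ means $[X,Y]=[X^\dagger,Y]=0$: - absolutely $(\sigma,\pi)$-microcausal: for $\mu_g$-a.e. $z$ and all $\beta,\gamma\in\Gamma^z$ with $\pi_z(\beta)\perp_\sigma\pi_z(\gamma)$, $V_\beta\phi_{s(\beta)}V_\beta^\dagger$ and $V_\gamma\psi_{s(\gamma)}V_\gamma^\dagger$ commute; - strongly $(\mathfrak S_{\mathcal R},\sigma,\pi)$-microcausal: for $\mu_g$-a.e. $z$, all $x\in\mathrm{supp}\,\mu^{\mathsf F^z_{\mathcal R,\pi}}_{\omega^{(1)}_z}$ and $y\in\mathrm{supp}\,\mu^{\mathsf F^z_{\mathcal R,\pi}}_{\omega^{(2)}_z}$ with $x\perp_\sigma y$, $\hat\phi^{\mathcal R,\pi}_{z,\omega^{(1)}}(x)$ and $\hat\psi^{\mathcal R,\pi}_{z,\omega^{(2)}}(y)$ commute; - weakly $(\mathfrak S_{\mathcal R},\sigma,\pi)$-microcausal: for $\mu_g$-a.e. $z$, if $\omega^{(1)}_z\perp^{\mathcal R,\pi}_\sigma\omega^{(2)}_z$ then $\hat\phi^{\mathcal R,\pi}_{z,\omega^{(1)}}(x)$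 and $\hat\psi^{\mathcal R,\pi}_{z,\omega^{(2)}}(y)$ commute for all $x,y$ in the respective supports; - strongly semi $(\mathfrak S_{\mathcal R},\sigma)$-causal: for $\mu_g$-a.e. $x,y$ with $x\perp_\sigma y$ and every arrow $\alpha:y\to x$, $\hat\Phi^{\mathcal R}_x(\omega^{(1)})$ and $V_\alpha\hat\Psi^{\mathcal R}_y(\omega^{(2)})V_\alpha^\dagger$ commute; - weakly semi $(\mathfrak S_{\mathcal R},\sigma,\pi)$-causal: the same, but only required when $\omega^{(1)}_x\perp^{\mathcal R,\pi}_\sigma\omega^{(2)}_y$; - $(\mathfrak S_{\mathcal R},\sigma,\pi)$-causal: if $\mathrm{Loc}_\pi(\mathcal R,\omega^{(1)})\perp_\sigma\mathrm{Loc}_\pi(\mathcal R,\omega^{(2)})$ then $\hat\Phi^{\mathcal R}(\omega^{(1)})$ and $\hat\Psi^{\mathcal R}(\omega^{(2)})$ commute. *)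

(* Defs.v *)
From HB Require Import structures.
From mathcomp Require Import all_boot all_order all_algebra complex.
From mathcomp Require Import all_classical all_reals all_analysis.
From Stdlib Require Import Relation_Operators.

Set Implicit Arguments.
Unset Strict Implicit.
Unset Printing Implicit Defensive.

Import Order.TTheory GRing.Theory Num.Theory numFieldNormedType.Exports.

Local Open Scope classical_set_scope.
Local Open Scope ring_scope.

(* The scalar product is conjugate-linear in its first argument. *)
Record hilbert (R : realType) := Hilbert {
  hcar :> completeNormedModType R[i];
  ip : hcar -> hcar -> R[i];
  ip_linear : forall x a y z, ip x (a *: y + z) = a * ip x y + ip x z;
  ip_conj : forall x y, ip y x = (ip x y)^*;
  ip_norm : forall x, ip x x = `|x| ^+ 2;
  hilbert_separable : exists2 D : set hcar, countable D & dense D }.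

Record bop (R : realType) (H K : hilbert R) := Bop {
  bop_fun :> {linear H -> K};
  bop_cont : continuous bop_fun }.

HB.instance Definition _ (R : realType) (H K : hilbert R) :=
  gen_eqMixin (bop H K).
HB.instance Definition _ (R : realType) (H K : hilbert R) :=
  gen_choiceMixin (bop H K).

Section Operators.
Variable R : realType.
Implicit Types H K L : hilbert R.

Lemma bop0_cont H K : continuous (\0 : {linear H -> K}).
Proof. by move=> x; apply: cst_continuous. Qed.
Definition bop0 H K : bop H K := Bop (@bop0_cont H K).

Lemma bcomp_cont H K L (A : bop K L) (B : bop H K) :
  continuous (A \o B : {linear H -> L}).
Proof.
move=> x; apply: (@continuous_comp _ _ _ B A); first exact: bop_cont.
exact: bop_cont.
Qed.
Definition bcomp H K L (A : bop K L) (B : bop H K) : bop H L :=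
  Bop (@bcomp_cont H K L A B).

Definition adj H K (A : bop H K) : bop K H :=
  xget (bop0 K H) [set B : bop K H | forall x y, ip (A x) y = ip x (B y)].

Definition conjop H K (V : bop H K) (A : bop H H) : bop K K :=
  bcomp V (bcomp A (adj V)).

Definition unitary H K (V : bop H K) :=
  (forall x y, ip (V x) (V y) = ip x y) /\ (forall y, exists x, V x = y).

(* In [R[i]], [0 <= z] entails that [z] is real. *)
Definition positive_op H (A : bop H H) := forall x, 0 <= ip x (A x).

Definition effect H (A : bop H H) :=
  positive_op A /\ forall x, ip x (A x) <= ip x x.

(* [[X, Y] = [X^dagger, Y] = 0] *)
Definition commute_ops H (X Y : bop H H) :=
  (forall v, X (Y v) = Y (X v)) /\ (forall v, adj X (Y v) = Y (adj X v)).

(* Zero vectors are allowed in the sequence, so that finite-dimensional spaces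
   are covered as well. *)
Definition is_onb H (e : nat -> H) :=
  [/\ forall i j, i <> j -> ip (e i) (e j) = 0,
      forall i, e i = 0 \/ ip (e i) (e i) = 1
    & forall x, (forall i, ip (e i) x = 0) -> x = 0].

Definition onb H : nat -> H := xget (fun=> 0) (@is_onb H).

(* |T| = (T^dagger T)^(1/2) *)
Definition abs_op H K (T : bop H K) : bop H H :=
  xget (bop0 H H)
    [set P : bop H H | positive_op P /\ forall x, P (P x) = adj T (T x)].

Definition trace_norm H K (T : bop H K) : \bar R :=
  (\sum_(0 <= k <oo)
     (complex.Re (ip (onb H k) (abs_op T (onb H k))))%:E)%E.

Definition trace_class H K (T : bop H K) := (trace_norm T < +oo)%E.

Definition trace H (A : bop H H) : R[i] :=
  lim ((fun N => \sum_(k < N) ip (onb H k) (A (onb H k)) : R[i]^o) @ \oo).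

Definition density H (w : bop H H) :=
  [/\ positive_op w, trace_class w & trace w = 1].

End Operators.

Section Integrals.
Context {R : realType} {d : measure_display} {T : measurableType d}.

Definition cmeasurable (f : T -> R[i]) :=
  measurable_fun setT (fun t => complex.Re (f t)) /\
  measurable_fun setT (fun t => complex.Im (f t)).

Definition cintegrable (m : {measure set T -> \bar R}) (D : set T)
    (f : T -> R[i]) :=
  m.-integrable D (fun t => (complex.Re (f t))%:E) /\
  m.-integrable D (fun t => (complex.Im (f t))%:E).

Definition cintegral (m : {measure set T -> \bar R}) (D : set T)
    (f : T -> R[i]) : R[i] :=
  (Rintegral m D (fun t => complex.Re (f t)) +i*
   Rintegral m D (fun t => complex.Im (f t)))%C.

(* Weak integral: the operator [A] with
   <x, A y> = \int_D <x, F t y> dm(t) for all [x], [y]; by convention [0] when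
   there is no such bounded operator. *)
Definition opintegral (H : hilbert R) (m : {measure set T -> \bar R})
    (D : set T) (F : T -> bop H H) : bop H H :=
  xget (bop0 H H)
    [set A : bop H H | forall x y,
       cintegrable m D (fun t => ip x (F t y)) /\
       ip x (A y) = cintegral m D (fun t => ip x (F t y))].

Definition povm (H : hilbert R) (E : set T -> bop H H) :=
  [/\ forall D, measurable D -> effect (E D),
      forall v, E setT v = v
    & forall v, semi_sigma_additive
                  (fun D : set T => (complex.Re (ip v (E D v)))%:E)].

(* [m D = Tr (w E(D))] *)
Definition is_born_measure (H : hilbert R) (E : set T -> bop H H)
    (w : bop H H) (m : {measure set T -> \bar R}) :=
  forall D, measurable D ->
    exists2 r : R, m D = r%:E & trace (bcomp w (E D)) = r%:C%C.

Definition born_measure (H : hilbert R) (E : set T -> bop H H) (w : bop H H) :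
    {measure set T -> \bar R} :=
  if pselect (exists m, is_born_measure E w m) is left ex
  then projT1 (cid ex) else mzero.

End Integrals.

Section Smooth.
Context {R : realType} {d : nat}.

Fixpoint iter_partial (l : seq 'I_d) (f : 'rV[R]_d -> R) : 'rV[R]_d -> R :=
  if l is i :: l' then fun u => 'D_(delta_mx 0 i) (iter_partial l' f) u
  else f.

(* To be used with an open [U]. *)
Definition smooth_on (U : set 'rV[R]_d) (f : 'rV[R]_d -> R) :=
  forall (l : seq 'I_d) u, U u ->
    {for u, continuous (iter_partial l f)} /\
    forall i, derivable (iter_partial l f) u (delta_mx 0 i).

Definition smoothv_on (U : set 'rV[R]_d) (f : 'rV[R]_d -> 'rV[R]_d) :=
  forall j, smooth_on U (fun u => f u 0 j).

(* Lebesgue measure on R^d, characterized by its values on boxes. *)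
Definition is_lebesgue
    (m : {measure set (g_sigma_algebraType (@open 'rV[R]_d)) -> \bar R}) :=
  forall a b : 'rV[R]_d, (forall i, a 0 i <= b 0 i) ->
    m [set u | forall i, a 0 i <= u 0 i < b 0 i] =
    (\prod_i (b 0 i - a 0 i))%:E.

End Smooth.

Record chart (R : realType) (d : nat) (M : topologicalType) := Chart {
  cdom : set M;
  cmap : M -> 'rV[R]_d;
  cinv : 'rV[R]_d -> M;
  cdom_open : open cdom;
  cimg_open : open (cmap @` cdom);
  cmapK : forall x, cdom x -> cinv (cmap x) = x;
  cmap_cont : forall x, cdom x -> {for x, continuous cmap};
  cinv_cont : forall u, (cmap @` cdom) u -> {for u, continuous cinv} }.

Record manifold (R : realType) (d : nat) := Manifold {
  mpts :> ptopologicalType;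
  mhausdorff : hausdorff_space mpts;
  mcountable : @second_countable mpts;
  atlas : set (chart R d mpts);
  (* A preferred chart around each point: a tangent vector at [x] is
     represented by its coordinates in [chart_at x]. *)
  chart_at : mpts -> chart R d mpts;
  chart_at_atlas : forall x, atlas (chart_at x);
  chart_at_dom : forall x, cdom (chart_at x) x;
  atlas_smooth : forall c c', atlas c -> atlas c' ->
    smoothv_on (cmap c @` (cdom c `&` cdom c')) (cmap c' \o cinv c) }.

Section Tangent.
Context {R : realType} {d : nat} {M : manifold R d}.
Implicit Types (c : chart R d M) (x : M).

(* Matrices act on row vectors from the right. *)
Definition to_chart c x : 'M[R]_d :=
  'J (cmap c \o cinv (chart_at x)) (cmap (chart_at x) x).

(* The rows are the coordinate vectors of [c] at [x]. *)
Definition of_chart c x : 'M[R]_d :=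
  'J (cmap (chart_at x) \o cinv c) (cmap c x).

(* Gram matrix at [x] of the coordinate vectors of [c], [G] being the Gram
   matrices in the preferred coordinates. *)
Definition gram_chart (G : M -> 'M[R]_d) c x : 'M[R]_d :=
  of_chart c x *m G x *m (of_chart c x)^T.

Definition gram_coord (G : M -> 'M[R]_d) c (u : 'rV[R]_d) : 'M[R]_d :=
  gram_chart G c (cinv c u).

Definition is_volume (G : M -> 'M[R]_d)
    (mu : {measure set (g_sigma_algebraType (@open M)) -> \bar R}) :=
  forall (c : chart R d M)
    (lambda : {measure set (g_sigma_algebraType (@open 'rV[R]_d)) -> \bar R})
    (A : set (g_sigma_algebraType (@open M))),
    atlas c -> is_lebesgue lambda -> measurable A -> A `<=` cdom c ->
    mu A = (\int[lambda]_(u in cmap c @` A)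
              (Num.sqrt `|\det (gram_coord G c u)|)%:E)%E.

End Tangent.

Definition minkowski (R : realType) (n : nat) : 'M[R]_n.+2 :=
  \matrix_(i, j) (if i != j then 0 else if i == 0 then 1 else -1).

(* Oriented and time-oriented Lorentzian spacetime of dimension [n.+2],
   signature (+,-,...,-). *)
Record spacetime (R : realType) (n : nat) := Spacetime {
  st_manifold :> manifold R n.+2;
  gram : st_manifold -> 'M[R]_n.+2;
  gram_lorentz : forall x, exists2 P : 'M[R]_n.+2,
    P \in unitmx & gram x = P *m minkowski R n *m P^T;
  gram_smooth : forall c, atlas c -> forall i j,
    smooth_on (cmap c @` cdom c) (fun u => gram_coord gram c u i j);
  (* [orient x = 1] iff [chart_at x] is positively oriented at [x]. *)
  orient : st_manifold -> R;
  orient_sign : forall x, orient x = 1 \/ orient x = -1;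
  orient_cont : forall c, atlas c -> forall x, cdom c x ->
    \forall y \near x, Num.sg (orient y * \det (to_chart c y)) =
                       Num.sg (orient x * \det (to_chart c x));
  (* A continuous timelike field, which is declared future-directed. *)
  tfield : st_manifold -> 'rV[R]_n.+2;
  tfield_timelike : forall x, 0 < (tfield x *m gram x *m (tfield x)^T) 0 0;
  tfield_cont : forall c, atlas c -> forall x, cdom c x ->
    {for x, continuous (fun y => tfield y *m to_chart c y)};
  vol : {measure set (g_sigma_algebraType (@open st_manifold)) -> \bar R};
  vol_is_volume : is_volume gram vol }.

(* Points of M as a measurable type, with the Borel sets. *)
Notation borel M := (g_sigma_algebraType (@open M)).

Section Causality.
Context {R : realType} {n : nat} {M : spacetime R n}.
Local Notation vec := 'rV[R]_n.+2.
Implicit Types (x y : M) (g : R -> M) (c : chart R n.+2 M) (N : set M).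

Definition metric x (v w : vec) : R := (v *m gram x *m w^T) 0 0.

Definition future x (v : vec) :=
  0 < metric x v v /\ 0 < metric x v (tfield x).

Definition smooth_curve g (a b : R) :=
  forall t, a < t < b -> {for t, continuous g} /\
    forall c, atlas c -> cdom c (g t) ->
      forall k, derivable (derive1n k (cmap c \o g : R -> vec)) t 1.

Definition velocity g (t : R) : vec :=
  derive1 (cmap (chart_at (g t)) \o g : R -> vec) t.

Definition christoffel c (u : vec) (k i j : 'I_n.+2) : R :=
  2^-1 * \sum_l invmx (gram_coord (@gram R n M) c u) k l *
    ('D_(delta_mx 0 i) (fun u => gram_coord (@gram R n M) c u j l) u +
     'D_(delta_mx 0 j) (fun u => gram_coord (@gram R n M) c u i l) u -
     'D_(delta_mx 0 l) (fun u => gram_coord (@gram R n M) c u i j) u).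

Definition geodesic g (a b : R) :=
  smooth_curve g a b /\
  forall t, a < t < b -> forall c, atlas c -> cdom c (g t) ->
    let xi : R -> vec := cmap c \o g in
    forall k, (derive1n 2 xi t) 0 k +
      \sum_i \sum_j christoffel c (xi t) k i j *
        (derive1 xi t) 0 i * (derive1 xi t) 0 j = 0.

(* [y] is the image of [v] under the exponential map at [x]. *)
Definition is_exp x (v : vec) y :=
  exists g a b, [/\ a < 0, 1 < b & geodesic g a b] /\
    [/\ g 0 = x, velocity g 0 = v & g 1 = y].

(* [N] is a normal neighbourhood of [x]: the exponential map [ex] at [x]
   restricts to a diffeomorphism from an open star-shaped set [W] onto [N]; and
   [lg] is its inverse on [N]. *)
Definition is_normal_log x N (lg : M -> vec) :=
  open N /\
  exists (W : set vec) (ex : vec -> M),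
    [/\ open W, W 0 & forall v t, W v -> 0 <= t <= 1 -> W (t *: v)] /\
    [/\ forall v, W v -> is_exp x v (ex v),
        ex @` W = N & forall v, W v -> lg (ex v) = v] /\
    [/\ forall v, W v -> {for v, continuous ex},
        forall c, atlas c ->
          smoothv_on (W `&` ex @^-1` cdom c) (cmap c \o ex)
      & forall c, atlas c ->
          smoothv_on (cmap c @` (N `&` cdom c)) (lg \o cinv c)].

(* Geodesically convex normal neighbourhood: a normal neighbourhood of each of
   its points. *)
Definition convex_normal N :=
  open N /\ forall x, N x -> exists lg, is_normal_log x N lg.

Definition causal_segment x y :=
  exists g a b, [/\ a < 0, 1 < b & smooth_curve g a b] /\
    [/\ g 0 = x, g 1 = y & forall t, 0 <= t <= 1 ->
        0 <= metric (g t) (velocity g t) (velocity g t) /\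
        0 < metric (g t) (velocity g t) (tfield (g t))].

(* [y] is in the causal future of [x]: they are equal or joined by a piecewise
   smooth future-directed causal curve. *)
Definition causal_future x y := clos_refl_trans M causal_segment x y.

Definition causal_complement (V : set M) : set M :=
  [set x | forall y, V y -> ~ causal_future x y /\ ~ causal_future y x].

(* The values of g_x(exp_x^-1(y), exp_x^-1(y)), where exp_x^-1 is taken in any
   convex normal neighbourhood common to x and y. *)
Definition cnn_values (U V : set M) : set (\bar R) :=
  [set r | exists x y N lg,
     [/\ U x, V y, N x & N y] /\
     [/\ convex_normal N, is_normal_log x N lg
       & r = (metric x (lg y) (lg y))%:E]].

Definition spacelike_sep (sigma : R) (U V : set M) :=
  U `<=` causal_complement V /\
  (ereal_sup (cnn_values U V) < (- sigma)%:E)%E.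

Definition measure_supp (m : {measure set (borel M) -> \bar R}) : set M :=
  [set y | forall U : set M, open U -> U y -> m U <> 0%E].

End Causality.

Record arrow (R : realType) (n : nat) (M : spacetime R n) (x y : M) := Arrow {
  amx : 'M[R]_n.+2;
  amx_isometry : forall v w, metric y (v *m amx) (w *m amx) = metric x v w;
  amx_orient : 0 < orient x * orient y * \det amx;
  amx_future : forall v, future x v -> future y (v *m amx) }.

Section Groupoid.
Context {R : realType} {n : nat} {M : spacetime R n}.

Lemma aid_isometry (x : M) v w :
  metric x (v *m 1%:M) (w *m 1%:M) = metric x v w.
Proof. by rewrite !mulmx1. Qed.
Lemma aid_orient (x : M) : 0 < orient x * orient x * \det (1%:M : 'M[R]_n.+2).
Proof.
by rewrite det1 mulr1; have [->|->] := orient_sign x; rewrite ?mulrNN mulr1.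
Qed.
Lemma aid_future (x : M) v : future x v -> future x (v *m 1%:M).
Proof. by rewrite mulmx1. Qed.
Definition aid (x : M) : arrow x x :=
  Arrow (@aid_isometry x) (@aid_orient x) (@aid_future x).

Section Composition.
Variables (x y z : M) (a : arrow y z) (b : arrow x y).
Let ab := amx b *m amx a.
Lemma acomp_isometry v w : metric z (v *m ab) (w *m ab) = metric x v w.
Proof. by rewrite /ab !mulmxA !amx_isometry. Qed.
Lemma acomp_orient : 0 < orient x * orient z * \det ab.
Proof.
have := mulr_gt0 (amx_orient b) (amx_orient a); rewrite /ab det_mulmx.
by have [->|->] := orient_sign y;
  rewrite !(mulr1, mul1r, mulrN1, mulN1r, mulNr, mulrN, opprK) mulrACA.
Qed.
Lemma acomp_future v : future x v -> future z (v *m ab).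
Proof. by move=> /(amx_future b)/(amx_future a); rewrite /ab mulmxA. Qed.
(* [acomp a b] is a o b. *)
Definition acomp : arrow x z := Arrow acomp_isometry acomp_orient acomp_future.
End Composition.

End Groupoid.

Record poin (R : realType) (n : nat) (M : spacetime R n) := Poin {
  psrc : M; ptgt : M; parr : arrow psrc ptgt }.

(* [tfib y] is the target fibre over [y]. *)
Record tfib (R : realType) (n : nat) (M : spacetime R n) (y : M) := Tfib {
  fsrc : M; farr : arrow fsrc y }.

HB.instance Definition _ (R : realType) (n : nat) (M : spacetime R n) :=
  gen_eqMixin (poin M).
HB.instance Definition _ (R : realType) (n : nat) (M : spacetime R n) :=
  gen_choiceMixin (poin M).
HB.instance Definition _ (R : realType) (n : nat) (M : spacetime R n) :=
  isPointed.Build (poin M) (Poin (aid (point : M))).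
HB.instance Definition _ (R : realType) (n : nat) (M : spacetime R n) (y : M) :=
  gen_eqMixin (tfib y).
HB.instance Definition _ (R : realType) (n : nat) (M : spacetime R n) (y : M) :=
  gen_choiceMixin (tfib y).
HB.instance Definition _ (R : realType) (n : nat) (M : spacetime R n) (y : M) :=
  isPointed.Build (tfib y) (Tfib (aid y)).

Section PoinTopology.
Context {R : realType} {n : nat} {M : spacetime R n}.
Local Notation vec := 'rV[R]_n.+2.
Local Notation mat := 'M[R]_n.+2.
Implicit Types c : chart R n.+2 M.

(* Source and target coordinates of an arrow, and its matrix with respect to
   the coordinate vectors of [c] and [c']. *)
Definition poin_coord c c' (a : poin M) : vec * vec * mat :=
  (cmap c (psrc a), cmap c' (ptgt a),
   of_chart c (psrc a) *m amx (parr a) *m to_chart c' (ptgt a)).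

Definition poin_dom c c' : set (poin M) :=
  [set a | cdom c (psrc a) /\ cdom c' (ptgt a)].

Definition poin_open (W : set (poin M)) :=
  forall c c', atlas c -> atlas c' -> exists2 O : set (vec * vec * mat),
    open O & W `&` poin_dom c c' = poin_coord c c' @^-1` O `&` poin_dom c c'.

Lemma poin_openT : poin_open setT.
Proof. by move=> c c' _ _; exists setT => //; exact: openT. Qed.

Lemma poin_openI : setI_closed poin_open.
Proof.
move=> A B oA oB c c' ac ac'.
have [P1 o1 e1] := oA _ _ ac ac'; have [P2 o2 e2] := oB _ _ ac ac'.
exists (P1 `&` P2); first exact: openI.
rewrite preimage_setI.
have -> : A `&` B `&` poin_dom c c' =
    (A `&` poin_dom c c') `&` (B `&` poin_dom c c') by rewrite setIACA setIid.
by rewrite e1 e2 setIACA setIid.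
Qed.

Lemma poin_open_bigU (I : Type) (f : I -> set (poin M)) :
  (forall i, poin_open (f i)) -> poin_open (\bigcup_i f i).
Proof.
move=> of_ c c' ac ac'.
have /choice[P oP] : forall i, exists P : set (vec * vec * mat), open P /\
    f i `&` poin_dom c c' = poin_coord c c' @^-1` P `&` poin_dom c c'.
  by move=> i; have [Q oQ e] := of_ i _ _ ac ac'; exists Q.
exists (\bigcup_i P i); first by apply: bigcup_open => i _; have [] := oP i.
rewrite preimage_bigcup !setI_bigcupl.
by apply: eq_bigcup => // i _; have [] := oP i.
Qed.

HB.instance Definition _ :=
  isOpenTopological.Build (poin M) poin_openT poin_openI poin_open_bigU.

Definition tfib_in (y : M) (b : tfib y) : poin M := Poin (farr b).

Definition tfib_open (y : M) : set (set (tfib y)) :=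
  [set @tfib_in y @^-1` W | W in open].

(* L_a b = a o b *)
Definition ltrans (x y : M) (a : arrow x y) (b : tfib x) : tfib y :=
  Tfib (acomp a (farr b)).

End PoinTopology.

(* Target fibre with its Borel sets. *)
Notation bfib y := (g_sigma_algebraType (@tfib_open _ _ _ y)).

Record hfield (R : realType) (M : topologicalType) := Hfield {
  hfib :> M -> hilbert R;
  csec : set (forall x, hfib x);
  csec0 : csec (fun x => 0);
  csecL : forall a s1 s2, csec s1 -> csec s2 ->
    csec (fun x => a *: s1 x + s2 x);
  csec_dense : forall x, dense [set s x | s in csec];
  csec_norm : forall s, csec s -> continuous (fun x : M => complex.Re `|s x| : R);
  csec_closed : forall s,
    (forall (x0 : M) (e : R), 0 < e -> exists2 s', csec s' &
       \forall x \near x0, `|s x - s' x| <= e%:C%C) -> csec s }.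

Section Fields.
Context {R : realType} {n : nat} {M : spacetime R n}.
Implicit Type H : hfield R M.

Definition opfield H := forall x : M, bop (H x) (H x).

Definition opfield_adj H (phi : opfield H) : opfield H :=
  fun x => adj (phi x).

Definition opfield_measurable H (phi : opfield H) :=
  forall s1 s2, csec s1 -> csec s2 ->
    cmeasurable (fun x : borel M => ip (s1 x) (phi x (s2 x))).

(* Essentially bounded measurable fields; they are representatives, not classes
   modulo a.e. equality. *)
Definition opfield_alg H : set (opfield H) :=
  [set phi | opfield_measurable phi /\
     exists C : R, {ae vol M, forall x, forall v, `|phi x v| <= C%:C%C * `|v|}].

Definition state_fields H : set (opfield H) :=
  [set w | opfield_alg w /\ {ae vol M, forall x, density (w x)}].

Definition convex_fields H (S : set (opfield H)) :=
  forall (w1 w2 w : opfield H) (t : R), S w1 -> S w2 -> 0 <= t <= 1 ->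
    (forall x v, w x v = t%:C%C *: w1 x v + (1 - t)%:C%C *: w2 x v) -> S w.

(* Commutation in A(H), where fields are identified when a.e. equal. *)
Definition commute_fields H (X Y : opfield H) :=
  {ae vol M, forall x, commute_ops (X x) (Y x)}.

Definition arrow_ops H := forall x y : M, arrow x y -> bop (H x) (H y).

(* [X] is a field of operators in T(H_t(a), H_s(a)) which is, locally, a
   trace-norm uniform limit of fields of the form
   sum_j |xi^j_s(a)> <eta^j_t(a)|. *)
Definition ultraweak_test H (X : forall a : poin M, bop (H (ptgt a)) (H (psrc a)))
  :=
  (forall a, trace_class (X a)) /\
  forall a0 : poin M, exists2 W, nbhs a0 W &
    forall e : R, 0 < e ->
      exists (m : nat) (xi eta : 'I_m -> forall x, H x),
        (forall j, csec (xi j) /\ csec (eta j)) /\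
        forall a, W a -> exists D : bop (H (ptgt a)) (H (psrc a)),
          (forall v, D v =
             X a v - \sum_j ip (eta j (ptgt a)) v *: xi j (psrc a)) /\
          (trace_norm D <= e%:E)%E.

Record unitary_rep H (U : arrow_ops H) := UnitaryRep {
  rep_unitary : forall x y (a : arrow x y), unitary (U x y a);
  rep_id : forall x v, U x x (aid x) v = v;
  rep_comp : forall x y z (a : arrow y z) (b : arrow x y) v,
    U x z (acomp a b) v = U y z a (U x y b v);
  rep_measurable : forall s1 s2, csec s1 -> csec s2 ->
    cmeasurable (fun a : borel (poin M) =>
      ip (s1 (ptgt a)) (U _ _ (parr a) (s2 (psrc a))));
  rep_ultraweak : forall X : (forall a : poin M, bop (H (ptgt a)) (H (psrc a))),
    ultraweak_test X ->
    continuous (fun a : poin M => trace (bcomp (U _ _ (parr a)) (X a)) : R[i]^o)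
  }.

End Fields.

Record system (R : realType) (n : nat) (M : spacetime R n) := System {
  sys_field : hfield R M;
  sys_rep : arrow_ops sys_field;
  sys_unitary : unitary_rep sys_rep }.

Record frame (R : realType) (n : nat) (M : spacetime R n) := Frame {
  fr_field : hfield R M;
  fr_rep : arrow_ops fr_field;
  fr_unitary : unitary_rep fr_rep;
  fr_povm : forall x : M, set (bfib x) -> bop (fr_field x) (fr_field x);
  fr_povm_povm : forall x, povm (@fr_povm x);
  fr_povm_measurable : forall W : set (borel (poin M)), measurable W ->
    opfield_measurable (fun x => fr_povm (@tfib_in _ _ _ x @^-1` W));
  fr_povm_covariant : forall (x y : M) (a : arrow x y) (D : set (bfib x)),
    measurable D -> forall v,
    conjop (fr_rep a) (fr_povm D) v = fr_povm (ltrans a @` D : set (bfib y)) v;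
  fr_admissible : {ae vol M, forall x : M, forall N : set (borel M),
    measurable N -> vol M N = 0%E ->
    forall v, fr_povm ([set b | N (fsrc b)] : set (bfib x)) v = 0 } }.

Section Relational.
Context {R : realType} {n : nat} {M : spacetime R n}.
Variables (Sys : system M) (Fr : frame M).
Local Notation HS := (sys_field Sys).
Local Notation HR := (fr_field Fr).

Definition frame_measure (x : M) (w : bop (HR x) (HR x)) :
    {measure set (bfib x) -> \bar R} :=
  born_measure (fr_povm Fr (x := x)) w.

(* V_b phi_s(b) V_b^dagger *)
Definition transported (phi : opfield HS) (x : M) (b : tfib x) :
    bop (HS x) (HS x) :=
  conjop (sys_rep Sys (farr b)) (phi (fsrc b)).

Definition semilocal (phi : opfield HS) (w : opfield HR) (x : M) :
    bop (HS x) (HS x) :=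
  opintegral (frame_measure (w x)) setT (transported phi (x := x)).

Definition global (phi : opfield HS) (w : opfield HR) : opfield HS :=
  fun x => semilocal phi w x.

Variable proj : forall x : M, bfib x -> borel M.

Definition loc_povm (x : M) (N : set (borel M)) : bop (HR x) (HR x) :=
  fr_povm Fr (proj (x := x) @^-1` N).

Definition loc_measure (x : M) (w : bop (HR x) (HR x)) :
    {measure set (borel M) -> \bar R} :=
  born_measure (loc_povm x) w.

Definition loc_supp (x : M) (w : bop (HR x) (HR x)) : set M :=
  measure_supp (loc_measure w).

Definition Loc (w : opfield HR) : set M := \bigcup_x loc_supp (w x).

Definition kernels :=
  forall x : M, bop (HR x) (HR x) -> R.-pker (borel M) ~> (bfib x).

Definition is_disintegration (nu : kernels) :=
  forall (x : M) (w : bop (HR x) (HR x)), density w ->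
    (forall (D : set (bfib x)) (L : set (borel M)),
       measurable D -> measurable L ->
       frame_measure w (D `&` proj (x := x) @^-1` L) =
       (\int[loc_measure w]_(y in L) nu x w y D)%E) /\
    {ae loc_measure w, forall y,
       nu x w y (~` (proj (x := x) @^-1` [set y])) = 0%E}.

Variable nu : kernels.

Definition local_field (phi : opfield HS) (w : opfield HR) (x : M) (y : M) :
    bop (HS x) (HS x) :=
  opintegral (nu (w x) y) (proj (x := x) @^-1` [set y])
    (transported phi (x := x)).

Variables (O : set (opfield HS)) (S : set (opfield HR)) (sigma : R).

Definition absolutely_microcausal :=
  forall phi psi, O phi -> O psi ->
  {ae vol M, forall z : M, forall b c : tfib z,
    spacelike_sep sigma [set proj b : M] [set proj c : M] ->
    commute_ops (transported phi b) (transported psi c)}.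

Definition strongly_microcausal :=
  forall phi psi w1 w2, O phi -> O psi -> S w1 -> S w2 ->
  {ae vol M, forall z : M, forall x y : M,
    loc_supp (w1 z) x -> loc_supp (w2 z) y ->
    spacelike_sep sigma [set x] [set y] ->
    commute_ops (local_field phi w1 z x) (local_field psi w2 z y)}.

Definition weakly_microcausal :=
  forall phi psi w1 w2, O phi -> O psi -> S w1 -> S w2 ->
  {ae vol M, forall z : M,
    spacelike_sep sigma (loc_supp (w1 z)) (loc_supp (w2 z)) ->
    forall x y : M, loc_supp (w1 z) x -> loc_supp (w2 z) y ->
    commute_ops (local_field phi w1 z x) (local_field psi w2 z y)}.

(* "For a.e. x, y": for all x, y outside some null set. *)
Definition strongly_semicausal :=
  forall phi psi w1 w2, O phi -> O psi -> S w1 -> S w2 ->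
  exists2 N : set M, (vol M).-negligible N &
    forall x y : M, ~ N x -> ~ N y ->
    spacelike_sep sigma [set x] [set y] ->
    forall a : arrow y x,
    commute_ops (semilocal phi w1 x)
                (conjop (sys_rep Sys a) (semilocal psi w2 y)).

Definition weakly_semicausal :=
  forall phi psi w1 w2, O phi -> O psi -> S w1 -> S w2 ->
  exists2 N : set M, (vol M).-negligible N &
    forall x y : M, ~ N x -> ~ N y ->
    spacelike_sep sigma [set x] [set y] ->
    spacelike_sep sigma (loc_supp (w1 x)) (loc_supp (w2 y)) ->
    forall a : arrow y x,
    commute_ops (semilocal phi w1 x)
                (conjop (sys_rep Sys a) (semilocal psi w2 y)).

Definition causal :=
  forall phi psi w1 w2, O phi -> O psi -> S w1 -> S w2 ->
  spacelike_sep sigma (Loc w1) (Loc w2) ->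
  commute_fields (global phi w1) (global psi w2).

End Relational.

(* Main.v *)
(* A weak operator integral of operators that commute with X commutes with X,
   since <u, A X v> and <X^dagger u, A v> are integrals of the same function;
   this is the passage from absolute to strong microcausality.
   For the passage from weak microcausality to causality, the semilocal field is
   the mixture of the local fields along the localization measure, which is
   carried by its support because M is second countable.  This uses that the
   local weak integral exists for almost every y: the operator field is
   essentially bounded, admissibility of the frame transfers its exceptional
   null set to the fibres, and Riesz representation turns the bounded form
   (u, v) |-> int <u, V_b phi_s(b) V_b^dagger v> dnu(b|y) into an operator.
   The fibrewise measurability needed for this comes from the existence of the
   semilocal weak integral; if that fails, the semilocal field is 0. *)

Require Import Defs.
From HB Require Import structures.
From mathcomp Require Import all_boot all_order all_algebra complex.
From mathcomp Require Import all_classical all_reals all_analysis.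
From mathcomp Require Import measurable_realfun.
From mathcomp Require Import ring lra.

Set Implicit Arguments.
Unset Strict Implicit.
Unset Printing Implicit Defensive.

Import Order.TTheory GRing.Theory Num.Theory numFieldNormedType.Exports.

Local Open Scope classical_set_scope.
Local Open Scope ring_scope.

(** * The underlying real inner product space *)

Section RealInnerProduct.
Variables (R : realType) (H : hilbert R).
Implicit Types (x y z : H) (a : R[i]) (r : R).

Definition rip x y : R := complex.Re (ip x y).
Definition nrm x : R := complex.Re `|x|.

Lemma normE x : `|x| = (nrm x)%:C%C.
Proof. by rewrite /nrm RRe_real. Qed.

Lemma nrm_ge0 x : 0 <= nrm x.
Proof. by rewrite -lecR -normE normr_ge0. Qed.

Lemma ipDr x y z : ip x (y + z) = ip x y + ip x z.
Proof. by rewrite -[y]scale1r ip_linear mul1r scale1r. Qed.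

Lemma ip0r x : ip x 0 = 0.
Proof. by apply: (addrI (ip x 0)); rewrite -ipDr !addr0. Qed.

Lemma ipZr x a y : ip x (a *: y) = a * ip x y.
Proof. by rewrite -[a *: y]addr0 ip_linear ip0r addr0. Qed.

Lemma ipZl x a y : ip (a *: x) y = a^* * ip x y.
Proof. by rewrite ip_conj ipZr rmorphM /= -ip_conj. Qed.

Lemma ripC x y : rip x y = rip y x.
Proof. by rewrite /rip ip_conj; case: (ip y x). Qed.

Lemma ripDr x y z : rip x (y + z) = rip x y + rip x z.
Proof. by rewrite /rip ipDr raddfD. Qed.

Lemma ripDl x y z : rip (y + z) x = rip y x + rip z x.
Proof. by rewrite ripC ripDr !(ripC x). Qed.

Lemma rip0r x : rip x 0 = 0.
Proof. by rewrite /rip ip0r. Qed.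

Lemma ripZr x r y : rip x (r%:C%C *: y) = r * rip x y.
Proof. by rewrite /rip ipZr; case: (ip x y) => u v /=; rewrite mul0r subr0. Qed.

Lemma ripZl x r y : rip (r%:C%C *: y) x = r * rip y x.
Proof. by rewrite ripC ripZr ripC. Qed.

Lemma ripNr x y : rip x (- y) = - rip x y.
Proof. by rewrite -scaleN1r -(rmorphN1 (real_complex R)) ripZr mulN1r. Qed.

Lemma ripNl x y : rip (- y) x = - rip y x.
Proof. by rewrite ripC ripNr ripC. Qed.

Lemma ripZ_conj a x y : rip x (a *: y) = rip (a^* *: x) y.
Proof. by rewrite /rip ipZr ipZl conjCK. Qed.

Lemma ripxx x : rip x x = nrm x ^+ 2.
Proof. by rewrite /rip ip_norm normE -rmorphXn. Qed.

(** Recovers the complex scalar product from its real part, so that identities, bounds and integrals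
    need treatment for [rip] only. *)
Lemma Im_ip x y : complex.Im (ip x y) = rip x (- 'i%C *: y).
Proof.
rewrite /rip ipZr; case: (ip x y) => u v /=.
by rewrite oppr0 mul0r mulN1r sub0r opprK.
Qed.

Lemma ipE x y : ip x y = (rip x y +i* rip x (- 'i%C *: y))%C.
Proof. by rewrite -Im_ip /rip; case: (ip x y). Qed.

Lemma nrm_eq0 x : nrm x = 0 -> x = 0.
Proof. by move=> x0; apply/eqP; rewrite -normr_eq0 normE x0. Qed.

Lemma rip_inj x y : (forall z, rip z x = rip z y) -> x = y.
Proof.
move=> xy; apply/subr0_eq/nrm_eq0/eqP; rewrite -sqrf_eq0 -ripxx ripDr ripNr.
by rewrite xy subrr.
Qed.

Lemma cauchy_schwarz x y : `|rip x y| <= nrm x * nrm y.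
Proof.
have [y0|y0] := eqVneq (nrm y) 0.
  by rewrite (nrm_eq0 y0) rip0r normr0 mulr_ge0 ?nrm_ge0.
have y_gt0 : 0 < nrm y by rewrite lt_def y0 nrm_ge0.
have key r : 0 <= nrm x ^+ 2 + 2 * r * rip x y + r ^+ 2 * nrm y ^+ 2.
  suff <- : nrm (x + r%:C%C *: y) ^+ 2 =
      nrm x ^+ 2 + 2 * r * rip x y + r ^+ 2 * nrm y ^+ 2 by exact: sqr_ge0.
  rewrite -[LHS]ripxx !(ripDl, ripDr) !(ripZl, ripZr) (ripC y x) !ripxx; ring.
rewrite -(@ler_pXn2r _ 2) ?nnegrE ?mulr_ge0 ?nrm_ge0// -normrX ger0_norm ?sqr_ge0//.
(* The minimizer in r of the quadratic in [key]; its value there is the discriminant inequality. *)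
have := key (- rip x y / nrm y ^+ 2).
set p := rip x y; set q := nrm y; set s := nrm x => h.
have q2 : 0 < q ^+ 2 by rewrite exprn_gt0.
have /(mulr_ge0 (ltW q2)) := h.
have -> : q ^+ 2 * (s ^+ 2 + 2 * (- p / q ^+ 2) * p + (- p / q ^+ 2) ^+ 2 * q ^+ 2)
   = (s * q) ^+ 2 - p ^+ 2 by field.
by rewrite subr_ge0.
Qed.

Lemma nrmB_sqr x y :
  nrm (x - y) ^+ 2 = 2 * nrm x ^+ 2 + 2 * nrm y ^+ 2 - nrm (x + y) ^+ 2.
Proof.
rewrite -!ripxx !(ripDl, ripDr, ripNl, ripNr) (ripC y x); ring.
Qed.

Lemma nrmZ r x : nrm (r%:C%C *: x) ^+ 2 = r ^+ 2 * nrm x ^+ 2.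
Proof. rewrite -!ripxx ripZl ripZr; ring. Qed.

(** Completeness with real tolerances. The norm of [H] takes values in [R[i]], but a positive
    element of [R[i]] is real. *)
Lemma complete_nrm (u : H ^nat) :
  (forall e : R, 0 < e -> \forall p \near \oo, \forall q \near \oo,
     nrm (u p - u q) < e) ->
  exists l, forall e : R, 0 < e -> \forall p \near \oo, nrm (l - u p) < e.
Proof.
move=> cu.
have : cauchy (u @ \oo).
  apply/cauchy_exP => e e0.
  have e0' : 0 < complex.Re e by move: e0; rewrite ltcE => /andP[].
  have eE : e = (complex.Re e)%:C%C by rewrite RRe_real// gtr0_real.
  have [N _ /(_ N (leqnn N))] := cu _ e0'.
  move=> [P _ hP]; exists (u N); exists P => // q Pq.
  by rewrite /= -ball_normE /= normE eE ltcR; exact: hP.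
move=> /cauchy_cvg/cvg_ex[l ul]; exists l => e e0.
have := @cvgr_dist_lt _ _ _ _ _ _ _ ul e%:C%C _; rewrite ltcR => /(_ _ e0).
by apply: filterS => p /=; rewrite normE ltcR.
Qed.

End RealInnerProduct.

(** * Riesz representation of bounded real-linear functionals *)

Section Riesz.
Variables (R : realType) (H : hilbert R).
Variable f : H -> R.
Hypothesis fD : forall u v, f (u + v) = f u + f v.
Hypothesis fZ : forall (r : R) u, f (r%:C%C *: u) = r * f u.
Variable K : R.
Hypothesis f_bounded : forall u, `|f u| <= K * nrm u.

Let J (u : H) : R := nrm u ^+ 2 / 2 - f u.

Let J_lb u : - (K ^+ 2 / 2) <= J u.
Proof.
have := sqr_ge0 (nrm u - K); have := le_trans (ler_norm _) (f_bounded u).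
rewrite /J => h1 h2; nra.
Qed.

Let m : R := inf (range J).

Let J_has_inf : has_inf (range J).
Proof.
split; first by exists (J 0), 0.
by exists (- (K ^+ 2 / 2)) => _ [u _ <-]; exact: J_lb.
Qed.

Let m_le u : m <= J u.
Proof. by apply: ge_inf; [case: J_has_inf|exists u]. Qed.

Let approx_min n : exists u, J u < m + n.+1%:R^-1.
Proof.
have [_ [u _ <-] hu] := @inf_adherent _ (range J) n.+1%:R^-1 (ltac:(by [])) J_has_inf.
by exists u.
Qed.

(* The parallelogram law makes a minimizing sequence of [J] Cauchy, and the
   first variation of [J] vanishes at its limit. *)
Lemma riesz_real : exists y, forall u, f u = rip y u.
Proof.
have [s hs] := choice approx_min.
have parallelogram p q :
    nrm (s p - s q) ^+ 2 <= 4 * p.+1%:R^-1 + 4 * q.+1%:R^-1.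
  have := m_le ((2^-1)%:C%C *: (s p + s q)).
  have := hs p; have := hs q; rewrite /J fZ fD nrmZ nrmB_sqr.
  set a := p.+1%:R^-1; set b := q.+1%:R^-1.
  move=> h1 h2 h3; nra.
have invn (e : R) : 0 < e -> \forall p \near \oo, p.+1%:R^-1 < e.
  by move=> e0; exact: (near_infty_natSinv_lt (PosNum e0)).
have [l sl] : exists l, forall e : R, 0 < e -> \forall p \near \oo, nrm (l - s p) < e.
  apply: complete_nrm => e e0.
  have e8 : 0 < e ^+ 2 / 8 by rewrite divr_gt0 ?exprn_gt0.
  have hN := invn _ e8.
  apply: filterS (hN) => p hp; apply: filterS (hN) => q hq.
  rewrite -(@ltr_pXn2r _ 2) ?nnegrE ?nrm_ge0 ?(ltW e0)//.
  apply: (le_lt_trans (parallelogram p q)).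
  move: hp hq; set a := p.+1%:R^-1; set b := q.+1%:R^-1 => hp hq; lra.
have variation v (t : R) : t * (f v - rip l v) <= t ^+ 2 * nrm v ^+ 2 / 2.
  apply/ler_addgt0Pr => e e0.
  (* Once [s p] is within d of l, replacing [rip (s p) v] by [rip l v] costs at most e / 2; the
     other e / 2 pays for the excess of [J (s p)] over m. The 1 keeps the denominator positive. *)
  pose d : R := e / 2 / (1 + `|t| * nrm v).
  have den0 : 0 < 1 + `|t| * nrm v by rewrite ltr_pwDl ?mulr_ge0 ?nrm_ge0.
  have d0 : 0 < d by rewrite !divr_gt0.
  have [p [hp hd]] : exists p, p.+1%:R^-1 < e / 2 /\ nrm (l - s p) < d.
    have e2 : 0 < e / 2 by rewrite divr_gt0.
    have [p] := filter_ex (filterI (invn _ e2) (sl _ d0)).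
    by move=> [? ?]; exists p.
  have := m_le (s p + t%:C%C *: v); have := hs p; rewrite /J fD fZ.
  have -> : nrm (s p + t%:C%C *: v) ^+ 2 =
      nrm (s p) ^+ 2 + 2 * t * rip (s p) v + t ^+ 2 * nrm v ^+ 2.
    rewrite -[LHS]ripxx !(ripDl, ripDr) !(ripZl, ripZr) (ripC v) !ripxx; ring.
  have hc : t * (rip (s p) v - rip l v) <= e / 2.
    have -> : rip (s p) v - rip l v = - rip (l - s p) v.
      rewrite ripDl ripNl; ring.
    apply: (le_trans (ler_norm _)); rewrite normrM normrN.
    apply: (le_trans (ler_wpM2l (normr_ge0 _) (cauchy_schwarz _ _))).
    rewrite mulrCA; apply: (@le_trans _ _ (d * (1 + `|t| * nrm v))).
      apply: ler_pM; rewrite ?nrm_ge0 ?mulr_ge0 ?nrm_ge0 ?(ltW hd)//.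
      by rewrite lerDr.
    by rewrite /d divfK// gt_eqF.
  move: hp hc; set c := p.+1%:R^-1 => hp hc h1 h2; nra.
exists l => v; apply/subr0_eq; set D := f v - rip l v.
have [v0|v0] := eqVneq (nrm v) 0.
  have := variation v 1; have := variation v (-1); rewrite v0 -/D => h1 h2; nra.
have h : D * (2^-1 * nrm v ^- 2 * D) <= 0 -> D = 0.
  rewrite mulrCA -expr2 => h; apply/eqP; rewrite -sqrf_eq0 eq_le sqr_ge0 andbT.
  move: h; rewrite pmulr_rle0// mulr_gt0// ?invr_gt0// exprn_gt0//.
  by rewrite lt_def v0 nrm_ge0.
(* This t minimizes t^2 * nrm v^2 / 2 - t * D. With X = D^2 / (2 * nrm v^2), [variation] then reads
   2 * X <= X. *)
apply: h; have := variation v (nrm v ^- 2 * D); rewrite -/D.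
have -> : (nrm v ^- 2 * D) ^+ 2 * nrm v ^+ 2 / 2 = D * (2^-1 * nrm v ^- 2 * D).
  by field.
move=> h.
have E : nrm v ^- 2 * D * D = 2 * (D * (2^-1 * nrm v ^- 2 * D)) by field.
rewrite E in h; lra.
Qed.

End Riesz.

(** * Operators from bounded forms, adjoints and commutation *)

Section BoundedOperators.
Variable R : realType.
Implicit Types H K : hilbert R.

Lemma bop_bounded H K (X : bop H K) :
  exists C : R, forall v, nrm (X v) <= C * nrm v.
Proof.
have /linear_boundedP/pinfty_ex_gt0[r r0 hr] :=
  @continuous_linear_bounded _ _ _ 0 X (@bop_cont _ _ _ X 0).
exists (complex.Re r) => v; have := hr v.
have -> : r = (complex.Re r)%:C%C by rewrite RRe_real// gtr0_real.
by rewrite !normE -rmorphM lecR.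
Qed.

(** Riesz representation for each fixed v gives A v. The third hypothesis is sesquilinearity seen
    through real parts: a scalar on v moves to u as its conjugate, which makes A complex linear.
    Testing with u = A v bounds A. *)
Lemma bounded_form_op H K (b : H -> K -> R) (C : R) :
  (forall u u' v, b (u + u') v = b u v + b u' v) ->
  (forall (r : R) u v, b (r%:C%C *: u) v = r * b u v) ->
  (forall a u v w, b u (a *: v + w) = b (a^* *: u) v + b u w) ->
  (forall u v, `|b u v| <= C * nrm v * nrm u) ->
  exists A : bop K H, forall u v, b u v = rip u (A v).
Proof.
move=> bD bZ bL bC.
have hv v : exists y, forall u, b u v = rip y u.
  apply: (@riesz_real R H (fun u => b u v) _ _ (C * nrm v)) => *;
    [exact: bD|exact: bZ|exact: bC].
have [A hA] := choice hv.
have linA : linear A.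
  move=> a v w; apply: rip_inj => u.
  by rewrite ripDr ripZ_conj !(ripC _ (A _)) -!hA bL.
pose LA := GRing.isLinear.Build _ _ _ _ A linA.
pose fA : {linear K -> H} := HB.pack A LA.
have A_le v : nrm (A v) <= `|C| * nrm v.
  have [->|A0] := eqVneq (nrm (A v)) 0; first by rewrite mulr_ge0 ?nrm_ge0.
  have A_gt0 : 0 < nrm (A v) by rewrite lt_def A0 nrm_ge0.
  rewrite -(ler_pM2r A_gt0) -expr2 -ripxx -hA.
  apply: (le_trans (ler_norm _)); apply: (le_trans (bC _ _)).
  by rewrite !ler_wpM2r ?nrm_ge0// ler_norm.
have cA : continuous fA.
  apply/bounded_linear_continuous/linear_boundedP.
  (* The bound must be a scalar of [R[i]]; anything above it is real, since the order of [R[i]] only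
     compares equal imaginary parts. *)
  exists (`|C|%:C)%C; split; first by apply/complex_realP; exists `|C|.
  move=> r; rewrite ltcE /= => /andP[/eqP r0 Cr] v.
  have -> : r = (complex.Re r)%:C%C by case: r r0 {Cr} => ? ? /= ->.
  rewrite !normE -rmorphM lecR; apply: (le_trans (A_le v)).
  by rewrite ler_wpM2r ?nrm_ge0 ?(ltW Cr).
by exists (Bop cA) => u v; rewrite hA ripC.
Qed.

(** Ensures that the choice in [adj] never falls back on its default 0. *)
Lemma adj_exists H K (A : bop H K) :
  exists B : bop K H, forall x y, ip (A x) y = ip x (B y).
Proof.
have [C hC] := bop_bounded A.
have [||||B hB] := @bounded_form_op H K (fun u v => rip (A u) v) C.
- by move=> u u' v; rewrite linearD ripDl.
- by move=> r u v; rewrite linearZ ripZl.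
- by move=> a u v w; rewrite ripDr ripZ_conj linearZ.
- move=> u v; apply: (le_trans (cauchy_schwarz _ _)).
  by rewrite mulrAC ler_wpM2r ?nrm_ge0.
exists B => x y; rewrite !ipE hB; congr (_ +i* _)%C.
by rewrite hB linearZ.
Qed.

Lemma ip_adj H K (A : bop H K) x y : ip (A x) y = ip x (adj A y).
Proof.
by move: x y; have := xgetPex (bop0 K H) (adj_exists A).
Qed.

Lemma rip_adj H K (A : bop H K) x y : rip (A x) y = rip x (adj A y).
Proof. by rewrite /rip ip_adj. Qed.

Lemma rip_adjl H K (A : bop H K) x y : rip (adj A x) y = rip x (A y).
Proof. by rewrite ripC -rip_adj ripC. Qed.

Definition commutes H (X Y : bop H H) := forall v, X (Y v) = Y (X v).

(** Taking adjoints turns X^dagger Y = Y X^dagger into Y^dagger X = X Y^dagger. *)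
Lemma commutes_adjlr H (X Y : bop H H) :
  commutes (adj X) Y <-> commutes X (adj Y).
Proof.
split=> XY v; apply: rip_inj => u.
- by rewrite -[LHS]rip_adjl -[LHS]rip_adj -[RHS]rip_adj -XY rip_adjl.
- by rewrite -[LHS]rip_adj -[LHS]rip_adjl -XY rip_adj rip_adjl.
Qed.

(** Here X occurs without a dagger, so a property of X that yields [commutes X Y] for a general Y
    need only be applied to Y and to its adjoint. Symmetry in X and Y also becomes visible. *)
Lemma commute_opsE H (X Y : bop H H) :
  commute_ops X Y <-> commutes X Y /\ commutes X (adj Y).
Proof.
by split=> -[h1 h2]; split=> //; apply/commutes_adjlr.
Qed.

Lemma commute_ops_sym H (X Y : bop H H) : commute_ops X Y -> commute_ops Y X.
Proof.
by move=> /commute_opsE[h1 h2]; split=> v; rewrite ?h1 ?h2.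
Qed.

Lemma commutes0 H (Y : bop H H) : commutes (bop0 H H) Y.
Proof. by move=> v /=; rewrite linear0. Qed.

End BoundedOperators.

(** * Weak operator integrals *)

Section WeakIntegral.
Context {R : realType} {d : measure_display} {T : measurableType d}.
Variable H : hilbert R.
Implicit Types (m : {measure set T -> \bar R}) (D : set T) (F : T -> bop H H).

Definition is_weak_integral m D F (A : bop H H) := forall x y,
  m.-integrable D (fun t => (rip x (F t y))%:E) /\
  rip x (A y) = Rintegral m D (fun t => rip x (F t y)).

(** The imaginary part at y is the real part at -i y, by [Im_ip]. *)
Lemma is_weak_integralP m D F (A : bop H H) :
  is_weak_integral m D F A <->
  forall x y, cintegrable m D (fun t => ip x (F t y)) /\
    ip x (A y) = cintegral m D (fun t => ip x (F t y)).
Proof.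
split=> h x y; last first.
  by have [[iR _] e] := h x y; split=> //; rewrite /rip e.
have imE t : complex.Im (ip x (F t y)) = rip x (F t (- 'i%C *: y)).
  by rewrite Im_ip linearZ.
have [iR eR] := h x y; have [iI eI] := h x (- 'i%C *: y).
split; first by split=> //; under [fun t : T => _]eq_fun do rewrite imE.
rewrite ipE -linearZ eR eI /cintegral.
by congr (_ +i* _)%C; congr Rintegral; apply/funext => t; rewrite imE.
Qed.

Lemma opintegralP m D F :
  opintegral m D F = bop0 H H \/ is_weak_integral m D F (opintegral m D F).
Proof.
rewrite /opintegral; case: xgetP => [A _ hA|_]; last by left.
by right; apply/is_weak_integralP.
Qed.

Lemma opintegral_is m D F (A : bop H H) :
  is_weak_integral m D F A -> is_weak_integral m D F (opintegral m D F).
Proof.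
move=> /is_weak_integralP hA; apply/is_weak_integralP.
rewrite /opintegral; case: xgetP => [B _ //|h]; by case: (h A).
Qed.

(** Existence of the weak integral is not assumed: the default 0 commutes with every operator. *)
Lemma opintegral_commutes m D F (Y : bop H H) :
  (forall t, D t -> commutes (F t) Y) -> commutes (opintegral m D F) Y.
Proof.
move=> FY; have [->|h] := opintegralP m D F; first exact: commutes0.
move=> v; apply: rip_inj => u.
rewrite -[RHS]rip_adjl (h u (Y v)).2 (h (adj Y u) v).2; apply: eq_Rintegral => t.
by move=> /set_mem/FY FYt; rewrite FYt rip_adjl.
Qed.

Lemma opintegral_commute_ops m D F (Y : bop H H) :
  (forall t, D t -> commute_ops (F t) Y) -> commute_ops (opintegral m D F) Y.
Proof.
move=> FY; apply/commute_opsE.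
by split; apply: opintegral_commutes => t /FY/commute_opsE[].
Qed.

Lemma weak_integral_unique m D F (A B : bop H H) :
  is_weak_integral m D F A -> is_weak_integral m D F B -> forall v, A v = B v.
Proof.
by move=> hA hB v; apply: rip_inj => u; rewrite (hA u v).2 (hB u v).2.
Qed.

End WeakIntegral.

(** * Almost-everywhere statements and conull sets *)

Section AlmostEverywhere.
Context {R : realType} {d : measure_display} {T : measurableType d}.
Variable mu : {measure set T -> \bar R}.
Implicit Types P Q : T -> Prop.

Lemma aeS P Q : (forall x, P x -> Q x) ->
  {ae mu, forall x, P x} -> {ae mu, forall x, Q x}.
Proof. exact: filterS. Qed.

Lemma aeI P Q : {ae mu, forall x, P x} -> {ae mu, forall x, Q x} ->
  {ae mu, forall x, P x /\ Q x}.
Proof. exact: filterI. Qed.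

End AlmostEverywhere.

Section NegligibleComplement.
Context {R : realType} {d : measure_display} {T : measurableType d}.
Variables (m : {measure set T -> \bar R}) (D E : set T) (f : T -> R).
Hypotheses (mD : measurable D) (mE : measurable E) (ED : E `<=` D).
Hypotheses (mf : measurable_fun D f) (m0 : m (~` E) = 0%E).

Let DE : E = D `\` (~` E).
Proof. by rewrite setDE setCK; apply/seteqP; split=> t; [split=> //; exact: ED|case]. Qed.

Lemma integrable_conull :
  m.-integrable E (EFin \o f) <-> m.-integrable D (EFin \o f).
Proof.
rewrite [X in m.-integrable X _ <-> _]DE.
split=> h; apply/(negligible_integrable (measurableC mE) mD _ m0) => //;
  exact/measurable_EFinP.
Qed.

Lemma Rintegral_conull :
  m.-integrable E (EFin \o f) -> Rintegral m E f = Rintegral m D f.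
Proof.
move=> /integrable_conull h; rewrite {1}DE /Rintegral.
by rewrite -(negligible_integral (measurableC mE) mD h m0).
Qed.

End NegligibleComplement.

(** * Integration against mixtures of probability measures *)

Section Mixture.
Context {R : realType} {d d' : measure_display}.
Context {Y : measurableType d} {Z : measurableType d'}.
Variables (F : {measure set Y -> \bar R}) (nu : R.-pker Y ~> Z).
Hypothesis F_lty : (F setT < +oo)%E.
Variable m : {measure set Z -> \bar R}.
Hypothesis mE : forall D, measurable D -> m D = (\int[F]_y nu y D)%E.

(* [integral_kcomp] composes kernels, so [F] is seen as a kernel from a point. *)
Let cst_ker : unit -> {measure set Y -> \bar R} := fun=> F.
Let cst_ker_measurable U : measurable U -> measurable_fun setT (cst_ker ^~ U).
Proof. by move=> _; exact: measurable_cst. Qed.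
HB.instance Definition _ :=
  isKernel.Build _ _ unit Y R cst_ker cst_ker_measurable.
Let cst_ker_uub : measure_fam_uub cst_ker.
Proof.
have F_fin : F setT \is a fin_num by rewrite ge0_fin_numE.
exists (fine (F setT) + 1)%R => -[]; rewrite /cst_ker EFinD fineK//.
by rewrite lteDl// lte01.
Qed.
HB.instance Definition _ :=
  Kernel_isFinite.Build _ _ unit Y R cst_ker cst_ker_uub.

Let nu_ker : unit * Y -> {measure set Z -> \bar R} := fun p => nu p.2.
Let nu_ker_measurable U : measurable U -> measurable_fun setT (nu_ker ^~ U).
Proof.
move=> mU; apply: (measurableT_comp (measurable_kernel nu U mU)).
exact: measurable_snd.
Qed.
HB.instance Definition _ :=
  isKernel.Build _ _ (unit * Y)%type Z R nu_ker nu_ker_measurable.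
Let nu_ker_prob p : nu_ker p setT = 1%E.
Proof. exact: prob_kernel. Qed.
HB.instance Definition _ :=
  Kernel_isProbability.Build _ _ (unit * Y)%type Z R nu_ker nu_ker_prob.

Lemma mixture_ge0_integral (f : Z -> \bar R) : (forall z, 0 <= f z)%E ->
  measurable_fun setT f -> (\int[m]_z f z = \int[F]_y \int[nu y]_z f z)%E.
Proof.
move=> f0 mf; rewrite -(integral_kcomp cst_ker nu_ker tt f0 mf).
by apply: eq_measure_integral => A mA _; rewrite mE.
Qed.

Lemma mixture_null (N : set Z) : measurable N -> m N = 0%E ->
  {ae F, forall y, nu y N = 0%E}.
Proof.
move=> mN; rewrite mE// => iN.
have /(ae_eq_integral_abs F measurableT (measurable_kernel nu N mN)) : 
    (\int[F]_y `|nu y N| = 0)%E.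
  by rewrite -[RHS]iN; apply: eq_integral => y _; rewrite gee0_abs.
by apply: aeS => y /(_ I).
Qed.

(** Since [mixture_ge0_integral] concerns nonnegative functions, f - g is split into positive and
    negative parts, whose integrals against almost every [nu y] coincide. *)
Lemma mixture_Rintegral_eq (f g : Z -> R) :
  m.-integrable setT (EFin \o f) -> m.-integrable setT (EFin \o g) ->
  {ae F, forall y,
    [/\ (nu y).-integrable setT (EFin \o f), (nu y).-integrable setT (EFin \o g)
      & Rintegral (nu y) setT f = Rintegral (nu y) setT g]} ->
  Rintegral m setT f = Rintegral m setT g.
Proof.
move=> mf mg fg; apply/subr0_eq; rewrite -RintegralB//.
pose h := EFin \o (f \- g).
have mh : measurable_fun setT h.
  by have := integrableB measurableT mf mg => /measurable_int.
rewrite /Rintegral -/h integralE.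
suff -> : (\int[m]_z h^\+ z = \int[m]_z h^\- z)%E.
  have : (\int[m]_z h^\- z)%E \is a fin_num.
    by apply: integrable_neg_fin_num => //; exact: (integrableB measurableT mf mg).
  by move=> hn; rewrite subee.
rewrite !mixture_ge0_integral//; [|exact: measurable_funeneg|exact: measurable_funepos].
apply: ge0_ae_eq_integral => //.
- apply: measurable_fun_integral_kernel => //; last exact: measurable_funepos.
  exact: measurable_kernel.
- apply: measurable_fun_integral_kernel => //; last exact: measurable_funeneg.
  exact: measurable_kernel.
- by move=> y _; exact: integral_ge0.
- by move=> y _; exact: integral_ge0.
apply: aeS fg => y [fy gy fgy] _.
have ih := integrableB measurableT fy gy.
have : (\int[nu y]_z h z = 0)%E.
  rewrite -(fineK (integrable_fin_num measurableT ih)).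
  by rewrite -[fine _]/(Rintegral (nu y) setT (f \- g)) RintegralB// fgy subrr.
rewrite integralE => /eqP; rewrite sube_eq.
- by rewrite add0e => /eqP.
- exact: integrable_pos_fin_num.
- by apply: fin_num_adde_defl; exact: integrable_neg_fin_num.
Qed.

Variable H : hilbert R.

(** A single operator represents the integral over D and over the whole space: the first is the
    local field, the second enters the mixture formula. *)
Lemma bounded_weak_integral (y : Y) (D : set Z) (G : Z -> bop H H) (C : R) :
  (forall u v, measurable_fun setT (fun z => rip u (G z v))) ->
  measurable D -> nu y (~` D) = 0%E ->
  {ae nu y, forall z, forall v, nrm (G z v) <= C * nrm v} ->
  exists2 A, is_weak_integral (nu y) D G A & is_weak_integral (nu y) setT G A.
Proof.
move=> mG mD nD [N [mN N0 NC]].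
(* On this conull set the bound on G holds everywhere, and the form b is integrated there. *)
pose E := D `\` N.
have mEE : measurable E by exact: measurableD.
have nE : nu y (~` E) = 0%E.
  rewrite /E setDE setCI setCK.
  by rewrite measureU0//; exact: measurableC.
have GC z : E z -> forall v, nrm (G z v) <= C * nrm v.
  move=> [_ Nz]; apply: contrapT => h; exact: Nz (NC _ h).
have GE u v : measurable_fun E (fun z => rip u (G z v)).
  by apply: measurable_funS (mG u v).
have Gb u v z : E z -> `|rip u (G z v)| <= C * nrm v * nrm u.
  move=> Ez; apply: (le_trans (cauchy_schwarz _ _)).
  by rewrite mulrC ler_wpM2r ?nrm_ge0// GC.
have icst k : (nu y).-integrable E (EFin \o cst k).
  apply: measurable_bounded_integrable => //.
    apply: (@le_lt_trans _ _ (nu y setT)); first by apply: le_measure; rewrite ?inE.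
    by rewrite prob_kernel ltry.
  by exists `|k|; split=> // r kr z _; exact: ltW.
have iG u v : (nu y).-integrable E (EFin \o (fun z => rip u (G z v))).
  apply: (@le_integrable _ _ _ (nu y) E mEE _ (EFin \o cst (C * nrm v * nrm u))).
  - by apply/measurable_EFinP; exact: GE.
  - by move=> z Ez; rewrite lee_fin; exact: le_trans (Gb u v z Ez) (ler_norm _).
  - exact: icst.
pose b u v := Rintegral (nu y) E (fun z => rip u (G z v)).
(* The constant is the integral of C over E. *)
have [||||A hA] := @bounded_form_op R H H b (fine (nu y E) * C).
- move=> u u' v; rewrite /b -RintegralD//.
  by apply: eq_Rintegral => z _; rewrite ripDl.
- move=> r u v; rewrite /b -RintegralZl//.
  by apply: eq_Rintegral => z _; rewrite ripZl.
- move=> a u v w; rewrite /b -RintegralD//.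
  by apply: eq_Rintegral => z _; rewrite linearP ripDr ripZ_conj.
- move=> u v; apply: (le_trans (le_normr_Rintegral mEE (iG u v))).
  apply: (@le_trans _ _ (Rintegral (nu y) E (cst (C * nrm v * nrm u)))).
    apply: le_Rintegral => //; last by move=> z; exact: Gb.
    + exact: (integrable_norm (iG u v)).
    + exact: icst.
  by rewrite Rintegral_cst// mulrC !mulrA.
have iGD D' : measurable D' -> E `<=` D' -> is_weak_integral (nu y) D' G A.
  move=> mD' ED' u v.
  have mGD : measurable_fun D' (fun z => rip u (G z v)).
    by apply: measurable_funS (mG u v).
  split; first by apply/(integrable_conull mD' mEE ED' mGD nE); exact: iG.
  by rewrite -(Rintegral_conull mD' mEE ED' mGD nE (iG u v)) -hA.
by exists A; apply: iGD => // z [].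
Qed.

(** The functions <u, G X v> and <X^dagger u, G v> have equal integrals against almost every [nu y],
    hence against m. *)
Lemma mixture_commutes (D : Y -> set Z) (G : Z -> bop H H) (C : R) (X : bop H H) :
  (forall y, measurable (D y)) ->
  {ae F, forall y, nu y (~` D y) = 0%E} ->
  {ae F, forall y, {ae nu y, forall z, forall v, nrm (G z v) <= C * nrm v}} ->
  {ae F, forall y, commutes (opintegral (nu y) (D y) G) X} ->
  commutes (opintegral m setT G) X.
Proof.
move=> mD nD GC GX; have [->|hG] := opintegralP m setT G; first exact: commutes0.
(* Measurability is read off from the integrability contained in the weak integral over m. *)
have mG u v : measurable_fun setT (fun z => rip u (G z v)).
  by apply/measurable_EFinP; exact: measurable_int (hG u v).1.
move=> v; apply: rip_inj => u; rewrite -[RHS]rip_adjl !(hG _ _).2.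
apply: mixture_Rintegral_eq; [exact: (hG _ _).1|exact: (hG _ _).1|].
apply: aeS (aeI nD (aeI GC GX)) => y [ny [Cy Xy]].
have [A AD AT] := bounded_weak_integral mG (mD y) ny Cy.
(* The operator A and the one chosen by [opintegral] agree pointwise, so A inherits commutation with
   X. *)
have XA w : A (X w) = X (A w).
  by rewrite !(weak_integral_unique AD (opintegral_is AD)).
split; [exact: (AT _ _).1|exact: (AT _ _).1|].
by rewrite -!(AT _ _).2 XA rip_adjl.
Qed.

End Mixture.

(** * Born measures *)

Section BornMeasure.
Context {R : realType} {d : measure_display} {T : measurableType d}.
Variables (H : hilbert R) (E : set T -> bop H H) (w : bop H H).

Lemma born_measure_lty : (born_measure E w setT < +oo)%E.
Proof.
rewrite /born_measure; case: pselect => [ex|_]; last by rewrite /mzero ltry.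
by case: (projT2 (cid ex) setT measurableT) => r -> _; rewrite ltry.
Qed.

Lemma born_measure_null D :
  measurable D -> (forall v, E D v = 0) -> born_measure E w D = 0%E.
Proof.
move=> mD ED; rewrite /born_measure; case: pselect => [ex|//].
case: (projT2 (cid ex) D mD) => r ->; rewrite /trace.
have -> : (fun N => \sum_(k < N) ip (onb H k) (bcomp w (E D) (onb H k))
    : R[i]^o) = fun=> 0.
  apply/funext => N; apply: big1 => k _.
  by rewrite /= ED linear0 ip0r.
by rewrite lim_cst; [case=> <-|exact: norm_hausdorff].
Qed.

End BornMeasure.

(** * Borel sets of the spacetime and of the target fibres *)

Section BorelSpacetime.
Context {R : realType} {n : nat} {M : spacetime R n}.

Lemma borel_open_measurable (U : set (borel M)) :
  open (U : set M) -> measurable U.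
Proof. exact: sub_sigma_algebra. Qed.

Lemma borel_set1_measurable (x : M) : measurable ([set x] : set (borel M)).
Proof.
rewrite -[X in measurable X]setCK; apply: measurableC.
apply: borel_open_measurable; apply: closed_openC.
by apply: accessible_closed_set1; apply: hausdorff_accessible; exact: mhausdorff.
Qed.

(** A point outside the support has a null open neighbourhood, hence a null basic one, and the basis
    is countable. *)
Lemma measure_supp_ae (m : {measure set (borel M) -> \bar R}) :
  {ae m, forall y, measure_supp m y}.
Proof.
have [B /countable_injP[f f_inj] [Bopen Bbasis]] := mcountable M.
(* Countability of the basis is given by an injection f into nat; F k is the null basic set of code
   k, or empty if there is none. *)
pose F k : set (borel M) := \bigcup_(b in [set b : set M | [/\ B b, m b = 0%E & f b = k]]) b.
suff : m.-negligible (~` measure_supp m) by [].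
apply: (negligibleS (A := \bigcup_k F k)).
  move=> y /= /existsNP[U /not_implyP[oU /not_implyP[Uy /contrapT mU]]].
  have [b [Bb b_y] bU] := Bbasis y U (open_nbhs_nbhs (conj oU Uy)).
  exists (f b) => //; exists b => //; split=> //.
  apply: (subset_measure0 (mu := m) _ _ bU mU); apply: borel_open_measurable => //.
  exact: Bopen.
apply: negligible_bigcup => k.
have [[b [Bb mb fb]]|none] := pselect
    (exists b : set M, [/\ B b, m b = 0%E & f b = k]).
  apply: (negligibleS (A := b : set (borel M))).
    move=> y [b' [Bb' _ fb'] b'y].
    by have -> : b = b' by apply: f_inj; rewrite ?inE// fb fb'.
  by apply/negligibleP => //; apply: borel_open_measurable; exact: Bopen.
apply: (negligibleS (A := set0)); last exact: negligible_set0.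
by move=> y [b hb _]; apply: none; exists b.
Qed.

(** Near a point of the image, membership in it amounts to lying in the open image of the chart and
    in the preimage of N under [cinv c], which is continuous there. *)
Lemma chart_image_open (c : chart R n.+2 M) (N : set M) :
  open N -> open (cmap c @` (N `&` cdom c)).
Proof.
move=> oN; rewrite openE => _ [x [Nx cx] <-].
have cu : (cmap c @` cdom c) (cmap c x) by exists x.
have h1 : nbhs (cmap c x) (cmap c @` cdom c).
  by apply: open_nbhs_nbhs; split=> //; exact: cimg_open.
have h2 : nbhs (cmap c x) (cinv c @^-1` N).
  apply: (cinv_cont cu); rewrite cmapK//.
  exact: open_nbhs_nbhs.
apply: filterS (filterI h1 h2) => _ [[y cy <-]]; rewrite /= cmapK// => Ny.
by exists y.
Qed.

Lemma psrc_open (N : set M) : open N -> open [set a : poin M | N (psrc a)].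
Proof.
move=> oN; suff : poin_open [set a : poin M | N (psrc a)] by [].
move=> c c' _ _.
exists [set p | (cmap c @` (N `&` cdom c)) p.1.1].
  apply: (@open_comp _ _ (fst \o fst) (cmap c @` (N `&` cdom c))).
    by move=> p _; apply: continuous_comp; exact: cvg_fst.
  exact: chart_image_open.
apply/seteqP; split=> [a [Na [ca c'a]]|a [[x [Nx cx] e] [ca c'a]]].
  by split=> //; exists (psrc a).
split=> //; rewrite /= -(cmapK ca).
by rewrite /poin_coord /= in e; rewrite -e cmapK.
Qed.

(** Makes the sets s^-1(N) occurring in admissibility measurable in the fibre; open N suffice, as
    they generate. *)
Lemma measurable_fsrc (x : M) :
  measurable_fun setT (@fsrc R n M x : bfib x -> borel M).
Proof.
apply: (@measurability _ _ _ _ _ _ (@open M : set (set (borel M)))) => //.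
move=> _ [N oN <-]; rewrite setTI.
apply: sub_sigma_algebra; exists [set a | N (psrc a)] => //.
exact: psrc_open.
Qed.

End BorelSpacetime.

(** * Norm bounds under unitary conjugation *)

Section UnitaryBounds.
Variable R : realType.

Lemma unitary_nrm (H K : hilbert R) (V : bop H K) v :
  unitary V -> nrm (V v) = nrm v.
Proof.
case=> Vip _; apply/eqP; rewrite -(@eqrXn2 _ 2) ?nrm_ge0//.
by rewrite -!ripxx /rip Vip.
Qed.

Lemma unitary_adj_nrm (H K : hilbert R) (V : bop H K) v :
  unitary V -> nrm (adj V v) = nrm v.
Proof.
move=> uV; have [Vip /(_ v)[x <-]] := uV; rewrite (unitary_nrm _ uV).
suff -> : adj V (V x) = x by [].
by apply: rip_inj => u; rewrite -rip_adj /rip Vip.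
Qed.

(** The constant does not depend on V, so one essential bound on a field serves for its transports
    along all arrows. *)
Lemma conjop_bounded (H K : hilbert R) (V : bop H K) (A : bop H H) (C : R) :
  unitary V -> (forall v, nrm (A v) <= C * nrm v) ->
  forall v, nrm (conjop V A v) <= C * nrm v.
Proof.
by move=> uV AC v; rewrite /= unitary_nrm// -(unitary_adj_nrm v uV).
Qed.

End UnitaryBounds.

(** * From local to semilocal commutation *)

Section SemilocalCommutation.
Context {R : realType} {n : nat} {M : spacetime R n}.
Variables (Sys : system M) (Fr : frame M).
Variable proj : forall x : M, bfib x -> borel M.
Hypothesis proj_measurable : forall x : M, measurable_fun setT (@proj x).
Variable nu : kernels Fr.
Hypothesis nu_disintegration : is_disintegration proj nu.

Definition admissible_at (x : M) := forall N : set (borel M),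
  measurable N -> vol M N = 0%E ->
  forall v, fr_povm Fr ([set b | N (fsrc b)] : set (bfib x)) v = 0.

Lemma frame_measure_null (z : M) w (N : set (borel M)) :
  admissible_at z -> measurable N -> vol M N = 0%E ->
  frame_measure (Fr := Fr) (x := z) w [set b | N (fsrc b)] = 0%E.
Proof.
move=> adm mN N0; apply: born_measure_null; last exact: adm.
by rewrite -[X in measurable X]setTI; exact: measurable_fsrc.
Qed.

Lemma semilocal_commutes phi w (z : M) (X : bop (sys_field Sys z) (sys_field Sys z)) :
  opfield_alg phi -> admissible_at z -> density (w z) ->
  (forall y, loc_supp proj (w z) y ->
     commutes (local_field proj nu phi w z y) X) ->
  commutes (semilocal phi w z) X.
Proof.
move=> [_ [C [N [mN N0 NC]]]] adm dw LX.
have [dis conc] := nu_disintegration dw.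
have mix (D : set (bfib z)) : measurable D ->
    frame_measure (w z) D = (\int[loc_measure proj (w z)]_y nu (w z) y D)%E.
  by move=> mD; rewrite -dis// preimage_setT setIT.
have mfib (y : M) : measurable (@proj z @^-1` [set y] : set (bfib z)).
  by rewrite -[X in measurable X]setTI; apply: proj_measurable => //;
     exact: borel_set1_measurable.
have mN' : measurable ([set b | N (fsrc b)] : set (bfib z)).
  by rewrite -[X in measurable X]setTI; exact: measurable_fsrc.
apply: (mixture_commutes _ mix (D := fun y => @proj z @^-1` [set y]) (C := C)) => //.
- exact: born_measure_lty.
(* The set N where the bound on phi may fail pulls back along the source map to a null set of the
   frame measure, hence of almost every kernel measure. *)
- apply: aeS (mixture_null mix mN' (frame_measure_null (w z) adm mN N0)) => y ny.
  exists [set b | N (fsrc b)]; split=> // b hb; apply: NC => /= bC; apply: hb.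
  move=> v; apply: conjop_bounded; first exact: (rep_unitary (sys_unitary Sys)).
  by move=> u; have := bC u; rewrite !normE -rmorphM lecR.
(* Commutation is known only for y in the support, which is conull. *)
- by apply: aeS (measure_supp_ae (loc_measure proj (w z))) => y; exact: LX.
Qed.

Lemma semilocal_commute_ops phi w (z : M)
    (X : bop (sys_field Sys z) (sys_field Sys z)) :
  opfield_alg phi -> admissible_at z -> density (w z) ->
  (forall y, loc_supp proj (w z) y ->
     commute_ops (local_field proj nu phi w z y) X) ->
  commute_ops (semilocal phi w z) X.
Proof.
move=> phiA adm dw LX; apply/commute_opsE.
by split; apply: semilocal_commutes => // y /LX/commute_opsE[].
Qed.

End SemilocalCommutation.

(** * Monotonicity of spacelike separation *)

Section Separation.
Context {R : realType} {n : nat} {M : spacetime R n}.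

Lemma cnn_valuesS (U U' V V' : set M) :
  U' `<=` U -> V' `<=` V -> cnn_values U' V' `<=` cnn_values U V.
Proof.
move=> UU VV r [x [y [N [lg [[Ux Vy Nx Ny] h]]]]].
by exists x, y, N, lg; split=> //; split=> //; [exact: UU|exact: VV].
Qed.

Lemma spacelike_sepS (sigma : R) (U U' V V' : set M) :
  U' `<=` U -> V' `<=` V -> spacelike_sep sigma U V -> spacelike_sep sigma U' V'.
Proof.
move=> UU VV [sUV supUV]; split.
  by move=> x /UU/sUV hx y /VV; exact: hx.
apply: le_lt_trans supUV; exact/ereal_sup_le/cnn_valuesS.
Qed.

End Separation.

(** * The implications between causality conditions *)

Section Implications.
Context {R : realType} {n : nat} {M : spacetime R n}.
Variables (Sys : system M) (Fr : frame M).
Variable proj : forall x : M, bfib x -> borel M.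
Variables (nu : kernels Fr) (O : set (opfield (sys_field Sys))).
Variables (S : set (opfield (fr_field Fr))) (sigma : R).

Lemma absolutely_strongly_microcausal :
  absolutely_microcausal proj O sigma -> strongly_microcausal proj nu O S sigma.
Proof.
move=> abs phi psi w1 w2 Ophi Opsi _ _.
apply: aeS (abs phi psi Ophi Opsi) => z hz x y _ _ xy.
(* The local field of psi is held fixed while b runs over the fibre above x; after exchanging the
   roles, c runs over the fibre above y. *)
apply: opintegral_commute_ops => b pb; apply: commute_ops_sym.
apply: opintegral_commute_ops => c pc; apply: commute_ops_sym; apply: hz.
by rewrite pb pc.
Qed.

Lemma strongly_weakly_microcausal :
  strongly_microcausal proj nu O S sigma -> weakly_microcausal proj nu O S sigma.
Proof.
move=> str phi psi w1 w2 Ophi Opsi S1 S2.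
apply: aeS (str phi psi w1 w2 Ophi Opsi S1 S2) => z hz sep x y x1 y2.
by apply: hz => //; apply: spacelike_sepS sep => _ ->.
Qed.

Lemma strongly_weakly_semicausal :
  strongly_semicausal O S sigma -> weakly_semicausal proj O S sigma.
Proof.
move=> str phi psi w1 w2 Ophi Opsi S1 S2.
have [N N0 hN] := str phi psi w1 w2 Ophi Opsi S1 S2.
by exists N => // x y Nx Ny xy _; exact: hN.
Qed.

End Implications.

Theorem theorem6p25 (R : realType) (n : nat) (M : spacetime R n)
  (Sys : system M) (O : set (opfield (sys_field Sys)))
  (O_alg : O `<=` @opfield_alg R n M (sys_field Sys))
  (O_adj : forall phi, O phi -> O (opfield_adj phi))
  (sigma : R) (sigma_ge0 : 0 <= sigma)
  (Fr : frame M)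
  (proj : forall x : M, bfib x -> borel M)
  (proj_measurable : forall x : M, measurable_fun setT (proj x))
  (nu : kernels Fr) (nu_disintegration : is_disintegration proj nu)
  (S : set (opfield (fr_field Fr)))
  (S_states : S `<=` @state_fields R n M (fr_field Fr))
  (S_convex : convex_fields S) :
  [/\ absolutely_microcausal proj O sigma ->
        strongly_microcausal proj nu O S sigma,
      strongly_microcausal proj nu O S sigma ->
        weakly_microcausal proj nu O S sigma,
      strongly_semicausal O S sigma ->
        weakly_semicausal proj O S sigma
    & weakly_microcausal proj nu O S sigma ->
        causal proj O S sigma].

Proof.
split.
- exact: absolutely_strongly_microcausal.
- exact: strongly_weakly_microcausal.
- exact: strongly_weakly_semicausal.
move=> weak phi psi w1 w2 Ophi Opsi S1 S2 sep.
have [_ dw1] := S_states _ S1; have [_ dw2] := S_states _ S2.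
have W := weak _ _ _ _ Ophi Opsi S1 S2.
apply: aeS (aeI (aeI dw1 dw2) (aeI (fr_admissible Fr) W)) => z [[d1 d2] [adm Wz]].
(* The supports at z are contained in the unions [Loc w1] and [Loc w2]. *)
have sep_z : spacelike_sep sigma (loc_supp proj (w1 z)) (loc_supp proj (w2 z)).
  by apply: spacelike_sepS sep => y hy; exists z.
(* Passing from local to semilocal fields is done in one argument at a time: first for phi against
   the fixed semilocal field of psi, then for psi against each local field of phi. *)
apply: (semilocal_commute_ops proj_measurable nu_disintegration (O_alg _ Ophi))
  => // x hx.
apply: commute_ops_sym.
apply: (semilocal_commute_ops proj_measurable nu_disintegration (O_alg _ Opsi))
  => // y hy.
by apply: commute_ops_sym; exact: Wz.
Qed.
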